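(* Let $n$ be a positive integer and $q=(q_1,\ldots,q_{d-1},n)\in\mathbb{Z}^d$, and set $q_d=1-\sum_{j=1}^{d-1}q_j$. Assume $q_i\mid n$ for all $i=1,\ldots,d$. For a positive integer $m$ let $q^{(m)}=(q_1,\ldots,q_{d-1},mn)$. Then there exist unique polynomials $L_1(x),L_2(x)$ (not depending on $m$) such that $$h^*_{\Delta(0,q^{(m)})}(x)=mx\,L_1(x)+L_2(x)\quad\text{for all positive integers } m,$$ namely $$L_1(x)=\sum_{j=0}^{n-1}x^{\left\lceil\frac{q_1j+q_1^+}{n}\right\rceil+\cdots+\left\lceil\frac{q_dj+q_d^+}{n}\right\rceil-1},\qquad L_2(x)=h^*_{\Delta(0,q)}(x)-\sum_{j=0}^{n-1}x^{\left\lceil\frac{q_1j+q_1^+}{n}\right\rceil+\cdots+\left\lceil\frac{q_dj+q_d^+}{n}\right\rceil}.$$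
   Context: For integer $a$, $a^+=\max(0,a)$. For $p=(p_1,\ldots,p_{d-1},N)\in\mathbb{Z}^d$ with $N\neq0$, $\Delta(0,p)=\mathrm{conv}\{\mathbf{0},\mathbf{e}_1,\ldots,\mathbf{e}_{d-1},N\mathbf{e}_d+\sum_{i=1}^{d-1}p_i\mathbf{e}_i\}\subset\mathbb{R}^d$, where $\mathbf{e}_i$ are the unit coordinate vectors and $\mathbf{0}$ the origin. For a $d$-dimensional integral polytope $\mathcal{P}$ with Ehrhart polynomial $i(\mathcal{P},t)=\#(t\mathcal{P}\cap\mathbb{Z}^d)$, the $h^*$-polynomial is defined by $1+\sum_{t\geq1}i(\mathcal{P},t)x^t=h^*_{\mathcal{P}}(x)/(1-x)^{d+1}$. *)

(* Defs.v *)
From HB Require Import structures.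
From mathcomp Require Import all_boot all_order all_algebra.
From mathcomp Require Import finmap all_classical all_reals.

Set Implicit Arguments.
Unset Strict Implicit.
Unset Printing Implicit Defensive.

Import Order.TTheory GRing.Theory Num.Theory.

Local Open Scope classical_set_scope.
Local Open Scope ring_scope.

Definition conv (R : realType) (V : lmodType R) (s : seq V) : set V :=
  [set x | exists w : 'I_(size s) -> R,
     [/\ forall i, 0 <= w i, \sum_i w i = 1 & x = \sum_i w i *: s`_i]].

Definition dilate (R : realType) (V : lmodType R) (t : nat) (P : set V) :
    set V :=
  [set t%:R *: x | x in P].

(* i(P, t); [fset_set] of an infinite set is empty, but t P is bounded for a
   polytope P. *)
Definition ehrhart (R : realType) (d : nat) (P : set 'rV[R]_d) (t : nat) :
    nat :=
  #|` fset_set [set z : 'rV[int]_d | dilate t P (map_mx intr z)] |.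

(* Formal power series are represented by their coefficient sequences. *)
Definition ehrhart_series (R : realType) (d : nat) (P : set 'rV[R]_d) :
    nat -> R :=
  fun t => if t == 0%N then 1 else (ehrhart P t)%:R.

Definition series_mul (R : realType) (f g : nat -> R) : nat -> R :=
  fun k => \sum_(i < k.+1) f i * g (k - i)%N.

(* Ehr_P(x) = h(x) / (1 - x)^(d+1), with the denominator cleared. *)
Definition is_hstar (R : realType) (d : nat) (P : set 'rV[R]_d)
    (h : {poly R}) : Prop :=
  forall k : nat,
    series_mul (ehrhart_series P) (fun i => ((1 - 'X) ^+ d.+1 : {poly R})`_i) k
    = h`_k.

Definition hstar (R : realType) (d : nat) (P : set 'rV[R]_d) : {poly R} :=
  xget 0 (is_hstar P).

Lemma hstar_eq (R : realType) (d : nat) (P : set 'rV[R]_d) (h : {poly R}) :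
  is_hstar P h -> hstar P = h.
Proof.
move=> Ph; have /= Pg := xgetPex 0 (ex_intro (is_hstar P) h Ph).
by apply/polyP => k; rewrite /hstar -Pg -Ph.
Qed.

(* The dimension is d = k.+1; the last coordinate of p is N, so that
   N e_d + sum_(i < d) p_i e_i is p itself. *)
Definition Delta0 (R : realType) (k : nat) (p : 'rV[int]_k.+1) :
    set 'rV[R]_k.+1 :=
  conv (0 :: rcons [seq delta_mx 0 (lift ord_max i) | i <- enum 'I_k]
                   (map_mx intr p)).

Definition extend_last (k : nat) (q : 'I_k -> int) (a : int) :
    'I_k.+1 -> int :=
  fun i => if unlift ord_max i is Some j then q j else a.

(* (q_1, ..., q_(d-1), N) *)
Definition qvec (k : nat) (q : 'I_k -> int) (N : nat) : 'rV[int]_k.+1 :=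
  \row_i extend_last q N%:Z i.

(* (q_1, ..., q_d) with q_d = 1 - (q_1 + ... + q_(d-1)) *)
Definition qfull (k : nat) (q : 'I_k -> int) : 'I_k.+1 -> int :=
  extend_last q (1 - \sum_j q j).

Definition pos_part (a : int) : int := Num.max 0 a.

Definition expo (k : nat) (q : 'I_k -> int) (n j : nat) : int :=
  \sum_(i < k.+1)
    Num.ceil (((qfull q i * j%:Z + pos_part (qfull q i))%:~R : rat) / n%:R).

Lemma sum_qfull (k : nat) (q : 'I_k -> int) : \sum_i qfull q i = 1.
Proof.
rewrite big_ord_recr /= /qfull /extend_last unlift_none addrC.
suff -> : \sum_(i < k) (if unlift ord_max (widen_ord (leqnSn k) i) is Some j
   then q j else 1 - \sum_j q j) = \sum_j q j by rewrite subrK.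
apply: eq_bigr => i _.
have -> : widen_ord (leqnSn k) i = lift ord_max i.
  by apply: val_inj; rewrite /= /bump leqNgt ltn_ord.
by rewrite liftK.
Qed.

(* Hence the absolute values in the exponents of [L1] and [L2] below are
   only casts from int to nat. *)
Lemma expo_gt0 (k : nat) (q : 'I_k -> int) (n j : nat) :
  (0 < n)%N -> 0 < expo q n j.
Proof.
move=> n0; rewrite -(ltr0z rat) /expo rmorph_sum /=.
apply: (@lt_le_trans _ _ (\sum_(i < k.+1)
  (((qfull q i * j%:Z + pos_part (qfull q i))%:~R : rat) / n%:R))); last first.
  by apply: ler_sum => i _; exact: ceil_ge.
rewrite -mulr_suml divr_gt0 ?ltr0n // -rmorph_sum /= ltr0z.
rewrite big_split /= -mulr_suml sum_qfull mul1r.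
apply: (@lt_le_trans _ _ (\sum_i qfull q i)); first by rewrite sum_qfull.
rewrite ler_wpDl //; apply: ler_sum => i _.
by rewrite /pos_part le_max lexx orbT.
Qed.

Definition L1 (R : realType) (k : nat) (q : 'I_k -> int) (n : nat) : {poly R} :=
  \sum_(0 <= j < n) 'X^(`|(expo q n j - 1)%R|%N).

Definition L2 (R : realType) (k : nat) (q : 'I_k -> int) (n : nat) : {poly R} :=
  hstar (@Delta0 R k (qvec q n)) - \sum_(0 <= j < n) 'X^(`|expo q n j|%N).

(* Main.v *)
Require Import Defs.
From mathcomp Require Import all_boot all_order all_algebra.
From mathcomp Require Import finmap all_classical all_reals.
From mathcomp Require Import zify ring.

(** In t Delta(0, (q, N)), a lattice point with last coordinate a is described
    by k + 1 inequalities z_i >= q_i a / N, the last one being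
    t - (z_1 + ... + z_k) >= q_d a / N.  Rounding up, the slice at a consists of
    the k-tuples of naturals with sum at most t - c(a), where c(a) is the sum of
    the ceilings of q_i a / N over i <= d.  As c(a + N) = c(a) + 1, the Ehrhart
    series is the sum over a < N of x^c(a), divided by (1 - x)^(k + 2).
    For N = m n write a = j m + r with r < m: the terms with r = 0 give the
    h*-polynomial for n, and since q_i divides n, every term with r > 0 has the
    exponent occurring in L_1 and L_2, whatever r is. *)

Set Implicit Arguments.
Unset Strict Implicit.
Unset Printing Implicit Defensive.

Import Order.TTheory GRing.Theory Num.Theory.

Local Open Scope ring_scope.

(** * Ceilings of quotients and the height of a slice *)

Definition ceil_div (b : int) (N : nat) : int :=
  Num.ceil ((b%:~R : rat) / N%:R).

Lemma ceil_div_le (b : int) (N : nat) (z : int) :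
  (0 < N)%N -> (ceil_div b N <= z) = (b <= z * N%:Z).
Proof.
move=> N0; rewrite /ceil_div ceil_le_int ler_pdivrMr ?ltr0n //.
by rewrite pmulrn -intrM ler_int.
Qed.

Lemma ceil_div_ge (b : int) (N : nat) :
  (0 < N)%N -> b <= ceil_div b N * N%:Z.
Proof. by move=> N0; rewrite -ceil_div_le. Qed.

Lemma ceil_divDM (b c : int) (N : nat) :
  (0 < N)%N -> ceil_div (b + c * N%:Z) N = ceil_div b N + c.
Proof.
move=> N0; apply/le_anti; rewrite ceil_div_le // mulrDl lerD2r ceil_div_ge //=.
rewrite -lerBrDr ceil_div_le // mulrBl lerBrDr.
exact: ceil_div_ge.
Qed.

(* [height q N a] is the least dilation factor t such that t Delta(0, (q, N))
   has a lattice point with last coordinate [a]. *)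
Definition height (k : nat) (q : 'I_k -> int) (N a : nat) : int :=
  \sum_(i < k.+1) ceil_div (qfull q i * a%:Z) N.

(** Without the ceilings the sum is [a / N], since the [qfull q i] sum to 1. *)
Lemma height_ge (k : nat) (q : 'I_k -> int) (N a : nat) :
  (0 < N)%N -> a%:Z <= height q N a * N%:Z.
Proof.
move=> N0; rewrite -[a%:Z]mul1r -(sum_qfull q) !mulr_suml.
by apply: ler_sum => i _; exact: ceil_div_ge.
Qed.

Lemma height_ge0 (k : nat) (q : 'I_k -> int) (N a : nat) :
  (0 < N)%N -> 0 <= height q N a.
Proof.
move=> N0; rewrite -(@pmulr_lge0 _ N%:Z) //.
exact: le_trans (height_ge _ _ N0).
Qed.

Lemma height_gt0 (k : nat) (q : 'I_k -> int) (N a : nat) :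
  (0 < N)%N -> (0 < a)%N -> 0 < height q N a.
Proof.
move=> N0 a0; rewrite -(@pmulr_lgt0 _ N%:Z) //.
exact: lt_le_trans (height_ge _ _ N0).
Qed.

Lemma height0 (k : nat) (q : 'I_k -> int) (N : nat) : height q N 0 = 0.
Proof.
by rewrite /height big1 // => i _; rewrite /ceil_div mulr0 mul0r ceil0.
Qed.

(** The [i]-th ceiling grows by [qfull q i * l], and these increments sum to [l]. *)
Lemma heightDM (k : nat) (q : 'I_k -> int) (N a l : nat) :
  (0 < N)%N -> height q N (a + l * N) = height q N a + l%:Z.
Proof.
move=> N0; rewrite -[l%:Z]mul1r -(sum_qfull q) mulr_suml -big_split /=.
by apply: eq_bigr => i _; rewrite PoszD PoszM mulrDr mulrA ceil_divDM.
Qed.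

Lemma le_natheight (k : nat) (q : 'I_k -> int) (N a : nat) :
  (0 < N)%N -> (a <= `|height q N a|%N * N)%N.
Proof.
move=> N0; have := height_ge q a N0.
by rewrite -{1}[height q N a]gez0_abs ?height_ge0 // -PoszM lez_nat.
Qed.

(** * Inequalities for lattice points of the dilated simplex *)

Lemma extend_last_lift (k : nat) (q : 'I_k -> int) (a : int) (i : 'I_k) :
  extend_last q a (lift ord_max i) = q i.
Proof. by rewrite /extend_last liftK. Qed.

Lemma extend_last_max (k : nat) (q : 'I_k -> int) (a : int) :
  extend_last q a ord_max = a.
Proof. by rewrite /extend_last unlift_none. Qed.

Lemma heightE (k : nat) (q : 'I_k -> int) (N a : nat) :
  height q N a = ceil_div ((1 - \sum_j q j) * a%:Z) N
                 + \sum_(i < k) ceil_div (q i * a%:Z) N.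
Proof.
rewrite /height (bigD1_ord ord_max) //= [qfull _ _]extend_last_max; congr (_ + _).
by apply: eq_bigr => i _; rewrite [qfull _ _]extend_last_lift.
Qed.

(** With weights on [nat] instead of ['I_(size s)], sums can be split once the size is known. *)
Lemma convP (R : realType) (V : lmodType R) (s : seq V) (x : V) :
  conv s x <-> exists W : nat -> R,
    [/\ forall i, (i < size s)%N -> 0 <= W i,
        \sum_(0 <= i < size s) W i = 1
      & x = \sum_(0 <= i < size s) W i *: s`_i].
Proof.
split=> [[w [w0 w1 ->]]|[W [W0 W1 ->]]].
  pose W i := if insub i is Some j then w j else 0.
  have WE (i : 'I_(size s)) : W i = w i by rewrite /W valK.
  exists W; split=> [i si||].
  - by rewrite /W insubT.
  - by rewrite big_mkord -[RHS]w1; apply: eq_bigr => i _; rewrite WE.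
  - by rewrite big_mkord; apply: eq_bigr => i _; rewrite WE.
by exists W; split=> [i||]; [exact: W0|rewrite -W1 big_mkord|rewrite big_mkord].
Qed.

(** Here [u], [w i] and [v] are the barycentric coordinates at the origin, the unit vectors and the
    apex [p]. *)
Lemma Delta0P (R : realType) (k : nat) (p : 'rV[int]_k.+1) (x : 'rV[R]_k.+1) :
  Delta0 p x <-> exists (u v : R) (w : 'I_k -> R),
    [/\ 0 <= u, 0 <= v, forall i, 0 <= w i, u + \sum_i w i + v = 1
      & (forall i, x 0 (lift ord_max i) = w i + v * (p 0 (lift ord_max i))%:~R)
        /\ x 0 ord_max = v * (p 0 ord_max)%:~R].
Proof.
rewrite /Delta0; set s := 0 :: _.
have ss : size s = k.+2 by rewrite /s /= size_rcons size_map size_enum_ord.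
have sM (i : 'I_k) : s`_i.+1 = delta_mx 0 (lift ord_max i).
  rewrite /s /= nth_rcons size_map size_enum_ord ltn_ord.
  by rewrite (nth_map i) ?size_enum_ord // nth_ord_enum.
have sL : s`_k.+1 = map_mx intr p.
  by rewrite /s /= nth_rcons size_map size_enum_ord ltnn eqxx.
have s0 : s`_0 = 0 by [].
clearbody s.
have sumE (U : zmodType) (F : nat -> U) :
    \sum_(0 <= i < size s) F i = F 0%N + \sum_(i < k) F i.+1 + F k.+1.
  by rewrite ss big_mkord big_ord_recl big_ord_recr /= addrA.
have coordL (W : nat -> R) (i : 'I_k) :
  (\sum_(0 <= j < size s) W j *: s`_j) 0 (lift ord_max i)
    = W i.+1 + W k.+1 * (p 0 (lift ord_max i))%:~R.
  rewrite sumE s0 scaler0 add0r sL !mxE; congr (_ + _).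
  rewrite summxE (bigD1 i) //= sM !mxE !eqxx mulr1 big1 ?addr0 // => j ji.
  by rewrite sM !mxE /= (inj_eq lift_inj) eq_sym (negPf ji) mulr0.
have coordM (W : nat -> R) :
  (\sum_(0 <= j < size s) W j *: s`_j) 0 ord_max
    = W k.+1 * (p 0 ord_max)%:~R.
  rewrite sumE s0 scaler0 add0r sL !mxE summxE big1 ?add0r // => j _.
  by rewrite sM !mxE /= (negPf (neq_lift _ _)) mulr0.
rewrite convP; split.
  move=> [W [W0 W1 ->]]; exists (W 0%N), (W k.+1), (fun i => W i.+1).
  split; [by apply: W0; rewrite ss|by apply: W0; rewrite ss| |by rewrite -W1 sumE|].
    by move=> i; apply: W0; rewrite ss !ltnS ltnW.
  by split.
move=> [u [v [w [u0 v0 w0 sum1 [xL xM]]]]].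
(* Among the indices of [s], [insub] fails only for [i = k.+1], the position of the apex. *)
pose W i := if i is j.+1 then (if insub j is Some l then w l else v) else u.
have Ww (i : 'I_k) : W i.+1 = w i by rewrite /W valK.
have Wv : W k.+1 = v by rewrite /W insubN // ltnn.
exists W; split.
- move=> [//|i] _; rewrite /W; case: insub => //.
- by rewrite sumE Wv -[RHS]sum1; under eq_bigr do rewrite Ww.
- apply/rowP => i; case: (unliftP ord_max i) => [j ->|->].
    by rewrite coordL Ww Wv.
  by rewrite coordM Wv.
Qed.

(** The conditions are [v >= 0], [w i >= 0] and [u >= 0], cleared of the denominators [t] and
    [N]. *)
Lemma dilate_Delta0P (R : realType) (k : nat) (q : 'I_k -> int) (N t : nat)
    (z : 'rV[int]_k.+1) : (0 < N)%N -> (0 < t)%N ->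
  dilate t (@Delta0 R k (qvec q N)) (map_mx intr z) <->
  [/\ 0 <= z 0 ord_max,
      forall i, q i * z 0 ord_max <= z 0 (lift ord_max i) * N%:Z
    & (1 - \sum_i q i) * z 0 ord_max
      <= (t%:Z - \sum_i z 0 (lift ord_max i)) * N%:Z].
Proof.
move=> N0 t0; set a := z 0 ord_max.
have tR : 0 < (t%:R : R) by rewrite ltr0n.
have NR : 0 < (N%:R : R) by rewrite ltr0n.
have tn0 := lt0r_neq0 tR; have Nn0 := lt0r_neq0 NR.
split.
  move=> [x /Delta0P [u [v [w [u0 v0 w0 sum1 [xL xM]]]]] xz].
  have zL i : (z 0 (lift ord_max i))%:~R = t%:R * (w i + v * (q i)%:~R) :> R.
    move/matrixP/(_ 0 (lift ord_max i)): xz.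
    by rewrite !mxE xL mxE extend_last_lift => <-.
  have zM : a%:~R = t%:R * (v * N%:R) :> R.
    by move/matrixP/(_ 0 ord_max): xz; rewrite !mxE xM mxE extend_last_max.
  split.
  - by rewrite -(ler0z R) zM !mulr_ge0 ?(ltW tR) ?(ltW NR).
  - move=> i; rewrite -(ler_int R) !intrM zM zL -pmulrn.
    rewrite -subr_ge0 (_ : _ - _ = t%:R * w i * N%:R); last by ring.
    by rewrite !mulr_ge0 ?(ltW tR) ?(ltW NR).
  - rewrite -(ler_int R) !intrM !intrB zM !rmorph_sum /= -!pmulrn.
    rewrite rmorph1 (eq_bigr _ (fun i _ => zL i)).
    rewrite -mulr_sumr big_split /= -mulr_sumr.
    rewrite -subr_ge0 (_ : _ - _ = t%:R * u * N%:R).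
      by rewrite !mulr_ge0 ?(ltW tR) ?(ltW NR).
    have -> : u = 1 - v - \sum_i w i by rewrite -sum1; ring.
    by ring.
move=> [a0 zL zM].
(* The barycentric coordinates of [z / t], solved from the last coordinate upwards. *)
pose v : R := a%:~R / N%:R / t%:R.
pose w i : R := ((z 0 (lift ord_max i))%:~R - (q i)%:~R * a%:~R / N%:R) / t%:R.
exists (t%:R^-1 *: map_mx intr z); last by rewrite scalerA mulfV ?scale1r.
apply/Delta0P; exists (1 - \sum_i w i - v), v, w; split.
- have -> : 1 - \sum_i w i - v =
    ((t%:R - \sum_i (z 0 (lift ord_max i))%:~R) * N%:R
      - (1 - \sum_i (q i)%:~R) * a%:~R) / N%:R / t%:R.
    rewrite /w -mulr_suml sumrB -!mulr_suml /v; field.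
    by rewrite tn0 Nn0.
  rewrite !divr_ge0 ?(ltW tR) ?(ltW NR) // subr_ge0.
  by move: zM; rewrite -(ler_int R) !intrM !intrB !rmorph_sum /= -!pmulrn.
- by rewrite !divr_ge0 ?ler0z ?(ltW tR) ?(ltW NR).
- move=> i; rewrite divr_ge0 ?(ltW tR) // subr_ge0 ler_pdivrMr //.
  by rewrite pmulrn -!intrM ler_int.
- by ring.
- split=> [i|]; rewrite !mxE ?extend_last_lift ?extend_last_max /w /v.
    by field; rewrite tn0 Nn0.
  by rewrite -pmulrn -/a; field; rewrite tn0 Nn0.
Qed.

(** * Counting lattice points slice by slice *)

(** Last coordinates are at most [t * N], so any larger [M] bounds the slices; leaving [M] free lets
    one range serve several [t]. *)
Lemma ehrhart_Delta0 (R : realType) (k : nat) (q : 'I_k -> int) (N t M : nat) :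
  (0 < N)%N -> (0 < t)%N -> (t * N < M)%N ->
  ehrhart (@Delta0 R k (qvec q N)) t =
  (\sum_(a < M | `|height q N a| <= t) 'C(k + (t - `|height q N a|), k))%N.
Proof.
move=> N0 t0 tNM; pose h a := `|height q N a|%N.
have hE a : (h a)%:Z = height q N a by rewrite gez0_abs ?height_ge0.
(* The subtraction is truncated; the first condition in [P] discards the slices with [h a > t]. *)
pose T := {a : 'I_M & k.-tuple 'I_(t - h a).+1}.
pose P := [pred p : T | (h (tag p) <= t) &&
                        (\sum_(i <- tagged p) i <= t - h (tag p))]%N.
(* Adding the ceilings back to the tuple of excesses recovers the lattice point. *)
pose f (p : T) : 'rV[int]_k.+1 :=
  \row_i extend_last (fun j => (tnth (tagged p) j)%:Z
                               + ceil_div (q j * (tag p)%:Z) N) (tag p)%:Z i.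
have fM p : f p 0 ord_max = (tag p)%:Z by rewrite mxE extend_last_max.
have fL p i : f p 0 (lift ord_max i) = (tnth (tagged p) i)%:Z
                               + ceil_div (q i * (tag p)%:Z) N.
  by rewrite mxE extend_last_lift.
have f_inj : injective f.
  move=> [a u] [b v] fE.
  have ab : a = b.
    by have := fM (Tagged _ v); rewrite -fE fM /= => -[] /val_inj.
  subst b; congr (Tagged _ _); apply: eq_from_tnth => i.
  have := fL (Tagged _ v) i; rewrite -fE fL /= => /addIr [].
  exact: val_inj.
have -> : ehrhart (@Delta0 R k (qvec q N)) t = #|P|.
  rewrite /ehrhart.
  (* Being the image of a finite set, the set of lattice points is finite, so [fset_set] does not
     take its default value. *)
  rewrite (_ : [set z | _]%classic = [set` [fset f p | p in P]%fset]%classic).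
    by rewrite set_fsetK card_imfset // cardE.
  apply/seteqP; split=> z /=.
    rewrite dilate_Delta0P // => -[].
    case zE: (z 0 ord_max) => [a|//] _ zL zM.
    have yge (i : 'I_k) : 0 <= z 0 (lift ord_max i) - ceil_div (q i * a%:Z) N.
      by rewrite subr_ge0 ceil_div_le.
    pose y (i : 'I_k) :=
      `|(z 0 (lift ord_max i) - ceil_div (q i * a%:Z) N)%R|%N.
    have yE i : (y i)%:Z = z 0 (lift ord_max i) - ceil_div (q i * a%:Z) N.
      by rewrite gez0_abs.
    have ysum : ((\sum_i y i) + h a <= t)%N.
      rewrite -ceil_div_le // in zM.
      rewrite -lez_nat PoszD hE heightE (big_morph Posz PoszD erefl).
      rewrite (eq_bigr _ (fun i _ => yE i)) sumrB.
      by rewrite [X in _ + X]addrC addrA subrK addrC -lerBrDr.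
    have aM : (a < M)%N.
      apply: leq_ltn_trans tNM; apply: leq_trans (le_natheight q a N0) _.
      by rewrite leq_mul2r (leq_trans (leq_addl _ _) ysum) orbT.
    have yb i : (y i < (t - h a).+1)%N.
      rewrite ltnS -(leq_add2r (h a)) subnK ?(leq_trans (leq_addl _ _) ysum) //.
      by apply: leq_trans ysum; rewrite leq_add2r (bigD1 i) //= leq_addr.
    have usum : (\sum_(i <- [tuple Ordinal (yb i) | i < k]) i = \sum_i y i)%N.
      by rewrite big_tuple; apply: eq_bigr => i _; rewrite tnth_mktuple.
    apply/imfsetP; exists (@Tagged _ (Ordinal aM)
      (fun a : 'I_M => k.-tuple 'I_(t - h a).+1) [tuple Ordinal (yb i) | i < k]).
      apply/andP; split; first exact: leq_trans (leq_addl _ _) ysum.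
      rewrite [leqLHS]usum.
      by rewrite leq_subRL ?(leq_trans (leq_addl _ _) ysum) // addnC.
    apply/rowP => i; case: (unliftP ord_max i) => [j ->|->].
      by rewrite fL /= tnth_mktuple /= yE subrK.
    by rewrite fM zE.
  move=> /imfsetP [[a u] /= /andP [/= ht usum] ->].
  rewrite dilate_Delta0P // fM /=; split=> // [i|].
    by rewrite fL /= -ceil_div_le // lerDr.
  rewrite -ceil_div_le // (eq_bigr _ (fun i _ => fL _ i)) big_split /=.
  move: usum; rewrite big_tuple leq_subRL // -lez_nat PoszD hE heightE.
  rewrite (big_morph Posz PoszD erefl) => usum.
  by rewrite lerBrDr [X in _ + X]addrC addrA.
(* There are ['C(k + s, k)] tuples of [k] naturals with sum at most [s]. *)
rewrite -sum1_card (eq_bigr (fun a : 'I_M =>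
    \sum_(u : k.-tuple 'I_(t - h a).+1 | \sum_(i <- u) i <= t - h a) 1)%N);
  last first.
  by move=> a _; rewrite -card_partial_ord_partitions -sum1dep_card.
by rewrite sig_big_dep.
Qed.

(** * From the Ehrhart series to the h*-polynomial *)

(** The expansion of [(1 - x)^-(k+1)], truncated after degree [K] to stay within polynomials; [Q]
    carries the error. *)
Lemma one_subX_mul_binomials (R : realType) (k K : nat) :
  exists Q : {poly R},
    (1 - 'X) ^+ k.+1 * \poly_(i < K.+1) ('C(k + i, k)%:R) = 1 - 'X^(K.+1) * Q.
Proof.
elim: k => [|k [Q IH]].
  exists 1; rewrite mulr1 expr1 poly_def.
  under eq_bigr do rewrite bin0 scale1r.
  by apply: oppr_inj; rewrite -mulNr !opprB -subrX1.
(* Up to degree [K] the next identity is Pascal's rule; in degree [K.+1] only the shifted top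
   coefficient [c] survives. *)
pose c : R := 'C(k.+1 + K, k.+1)%:R.
have step : (1 - 'X) * \poly_(i < K.+1) ('C(k.+1 + i, k.+1)%:R)
    = \poly_(i < K.+1) ('C(k + i, k)%:R) - 'X^(K.+1) * c%:P :> {poly R}.
  apply/polyP => i; rewrite mulrBl mul1r !coefB coefXM !coef_poly coefXnM coefC.
  case: i => [|i]; first by rewrite !addn0 !binn /= !subr0.
  rewrite /= subn_eq0 addSnnS ltnS.
  case: (ltngtP i K) => [iK|Ki|->] /=.
  - by rewrite ltnS (ltnW iK) addnS binS natrD addSnnS addrC addKr subr0.
  - by rewrite ltnS leqNgt Ki.
  - by rewrite ltnSn.
exists (Q + (1 - 'X) ^+ k.+1 * c%:P).
rewrite exprSr -mulrA step mulrBr IH; ring.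
Qed.

(** By [heightDM] the [l]-th period is ['X^l] times the first, which leaves a geometric sum. *)
Lemma sum_height_periods (R : realType) (k : nat) (q : 'I_k -> int) (N K : nat) :
  (0 < N)%N ->
  (1 - 'X) * \sum_(0 <= a < K * N) 'X^`|height q N a| =
  (1 - 'X^K) * \sum_(0 <= a < N) 'X^`|height q N a| :> {poly R}.
Proof.
move=> N0; rewrite big_nat_mul.
have -> : \sum_(0 <= l < K) \sum_(l * N <= a < l.+1 * N) 'X^`|height q N a|
    = (\sum_(l < K) 'X^l) * \sum_(0 <= a < N) 'X^`|height q N a| :> {poly R}.
  rewrite big_mkord mulr_suml; apply: eq_bigr => l _.
  rewrite -{1}[(l * N)%N]add0n big_addn mulSn addnK mulr_sumr.
  apply: eq_bigr => a _; rewrite heightDM // -exprD; congr ('X^_).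
  by have := height_ge0 q a N0; lia.
rewrite mulrA; congr (_ * _).
by apply: oppr_inj; rewrite -mulNr !opprB -subrX1.
Qed.

Lemma is_hstar_Delta0 (R : realType) (k : nat) (q : 'I_k -> int) (N : nat) :
  (0 < N)%N ->
  is_hstar (@Delta0 R k (qvec q N)) (\sum_(0 <= a < N) 'X^`|height q N a|).
Proof.
(* This [M] exceeds [t * N] for every [t <= K], and only these [t] enter the coefficient of degree
   [K]. *)
move=> N0 K; pose M := (K.+1 * N)%N.
pose G : {poly R} := \sum_(0 <= a < M) 'X^`|height q N a|.
pose B : {poly R} := \poly_(i < K.+1) ('C(k + i, k)%:R).
have coefGB i : (i <= K)%N -> (G * B)`_i =
    (\sum_(a < M | `|height q N a| <= i) 'C(k + (i - `|height q N a|), k))%N%:R.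
  move=> iK; rewrite /G mulr_suml coef_sum big_mkord natr_sum [RHS]big_mkcond /=.
  apply: eq_bigr => a _; rewrite coefXnM ltnNge coef_poly.
  by case: (leqP `|_| i) => //= _; rewrite ltnS (leq_trans (leq_subr _ _) iK).
have EGB i : (i <= K)%N ->
    ehrhart_series (@Delta0 R k (qvec q N)) i = (G * B)`_i.
  move=> iK; rewrite coefGB // /ehrhart_series; case: posnP => [->|i0].
    (* The constant term is 1, because only [a = 0] has height 0. *)
    have M0 : (0 < M)%N by rewrite muln_gt0.
    rewrite (big_pred1 (Ordinal M0)) /= ?height0 ?addn0 ?binn // => a /=.
    rewrite leqn0 absz_eq0 -val_eqE /=.
    have [->|a0] := posnP a; first by rewrite height0 eqxx.
    by rewrite gt_eqF ?height_gt0.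
  by rewrite (@ehrhart_Delta0 _ _ _ _ _ M) // ltn_pmul2r.
transitivity (G * B * (1 - 'X) ^+ k.+2)`_K.
  rewrite coefM /series_mul; apply: eq_bigr => -[i /=]; rewrite ltnS => iK _.
  by rewrite EGB.
have [Q BQ] := one_subX_mul_binomials R k K.
set H : {poly R} := \sum_(0 <= a < N) _.
have GH : (1 - 'X) * G = (1 - 'X^(K.+1)) * H by exact: sum_height_periods.
(* Both truncation errors are multiples of ['X^(K.+1)], hence invisible in degree [K]. *)
have -> : G * B * (1 - 'X) ^+ k.+2 = H - 'X^(K.+1) * (H * (1 + Q - 'X^(K.+1) * Q)).
  transitivity (((1 - 'X) * G) * ((1 - 'X) ^+ k.+1 * B)).
    by rewrite [_ ^+ k.+2]exprS; ring.
  by rewrite GH BQ; ring.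
by rewrite coefB coefXnM ltnSn subr0.
Qed.

(** * Comparing the heights for [m * n] and [n] *)

(* With n = s c the two quotients are (j + r / m) / s and (j + [c > 0]) / s;
   rounding up only sees the ceiling (c > 0) or the floor (c < 0) of j + r / m. *)
Lemma ceil_div_block (c : int) (n m j r : nat) :
  (0 < n)%N -> (c %| n%:Z)%Z -> (0 < r < m)%N ->
  ceil_div (c * (j * m + r)%:Z) (m * n) = ceil_div (c * j%:Z + pos_part c) n.
Proof.
move=> n0 /dvdzP [s ns] /andP [r0 rm]; have mn0 : (0 < m * n)%N by rewrite muln_gt0 n0 (ltn_trans r0 rm).
have key z : (ceil_div (c * (j * m + r)%:Z) (m * n) <= z)
           = (ceil_div (c * j%:Z + pos_part c) n <= z).
  rewrite !ceil_div_le // /pos_part PoszM ns.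
  (* The case [c = 0] would force [n = 0]. *)
  case: (ltrgt0P c) => c0; last by move: ns; rewrite c0; lia.
  - rewrite (_ : z * _ = c * (z * s * m)); last by ring.
    rewrite (_ : z * (s * c) = c * (z * s)); last by ring.
    rewrite (_ : c * j + c = c * (j + 1)); last by ring.
    rewrite !ler_pM2l //; apply/idP/idP; nia.
  - rewrite (_ : z * _ = c * (z * s * m)); last by ring.
    rewrite (_ : z * (s * c) = c * (z * s)); last by ring.
    rewrite addr0 !ler_nM2l //; apply/idP/idP; nia.
by apply/le_anti; rewrite key lexx -key lexx.
Qed.

Lemma ceil_divMM (c : int) (n m j : nat) :
  (0 < n)%N -> (0 < m)%N ->
  ceil_div (c * (j * m)%:Z) (m * n) = ceil_div (c * j%:Z) n.
Proof.
move=> n0 m0; rewrite /ceil_div; congr Num.ceil.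
rewrite PoszM mulrA intrM natrM -pmulrn; field.
by rewrite !pnatr_eq0 -!lt0n n0.
Qed.

Lemma sum_height_blocks (R : realType) (k : nat) (q : 'I_k -> int) (n m : nat) :
  (0 < n)%N -> (forall i, (qfull q i %| n%:Z)%Z) -> (0 < m)%N ->
  \sum_(0 <= a < m * n) 'X^`|height q (m * n) a| =
  \sum_(0 <= j < n) 'X^`|height q n j|
  + m.-1%:R *: \sum_(0 <= j < n) 'X^`|expo q n j| :> {poly R}.
Proof.
move=> n0 q_dvd m0; rewrite {1}mulnC big_nat_mul scaler_sumr -big_split /=.
apply: eq_bigr => j _; rewrite -{1}[(j * m)%N]add0n big_addn mulSn addnK.
rewrite big_ltn // add0n; congr (_ + _).
  congr 'X^`| _ |; apply: eq_bigr => i _; exact: ceil_divMM.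
(* The remaining [m - 1] terms of the block are all equal, by divisibility. *)
rewrite (eq_big_nat _ _ (F2 := fun=> 'X^`|expo q n j|)) => [|r /andP [r0 rm]].
  by rewrite sumr_const_nat subn1 scaler_nat.
congr 'X^`| _ |; apply: eq_bigr => i _.
by rewrite addnC (@ceil_div_block _ n) // r0.
Qed.

Theorem theorem5p1 (R : realType) (k : nat) (q : 'I_k -> int) (n : nat)
    (n_gt0 : (0 < n)%N)
    (q_dvd : forall i : 'I_k.+1, (qfull q i %| n%:Z)%Z) :
  (forall m : nat, (0 < m)%N ->
     hstar (@Delta0 R k (qvec q (m * n))) = m%:R *: ('X * L1 R q n) + L2 R q n)
  /\
  (forall M1 M2 : {poly R},
     (forall m : nat, (0 < m)%N ->
        hstar (@Delta0 R k (qvec q (m * n))) = m%:R *: ('X * M1) + M2) ->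
     M1 = L1 R q n /\ M2 = L2 R q n).
Proof.
have hE m : (0 < m)%N ->
    hstar (@Delta0 R k (qvec q (m * n))) = m%:R *: ('X * L1 R q n) + L2 R q n.
  move=> m0; have XL1 : 'X * L1 R q n = \sum_(0 <= j < n) 'X^`|expo q n j|.
    rewrite /L1 mulr_sumr; apply: eq_bigr => j _; rewrite -exprS; congr 'X^_.
    by have := expo_gt0 q j n_gt0; lia.
  rewrite XL1 /L2 !(hstar_eq (is_hstar_Delta0 _ _ _)) ?muln_gt0 ?m0 //.
  (* Writing [m = m.-1 + 1], the extra copy of the sum cancels the one subtracted in [L2]. *)
  rewrite sum_height_blocks // -[in RHS](prednK m0) -natr1 scalerDl scale1r; ring.
split=> // M1 M2 hM.
(* Two values of [m] determine a polynomial affine in [m]: subtracting gives ['X * M1], then [M2]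
   follows. *)
have e1 := hM 1%N isT; have e2 := hM 2%N isT.
rewrite hE // in e1; rewrite hE // in e2.
have XM : 'X * M1 = 'X * L1 R q n.
  rewrite !scale1r in e1; rewrite !scaler_nat !mulr2n -!addrA e1 in e2.
  exact/esym/(addIr _ e2).
split; first by apply: (mulfI _ XM); rewrite polyX_eq0.
by move: e1; rewrite !scale1r XM => /addrI.
Qed.
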